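(* Assume that the iteration steps of PGA-$\mathcal{B}$, $$\mathbf{x}_{k+1}=\underset{\mathbf{x}\in C}{\operatorname{argmin}}\Big\{g(\mathbf{x})+\langle \mathbf{x},\nabla f(\mathbf{x}_k)\rangle+\tfrac{1}{\gamma_k}D_h(\mathbf{x},\mathbf{x}_k)\Big\},\qquad \gamma_k>0,\quad k=0,1,2,\ldots,$$ are well defined. Then for every $k$ this iteration step is equivalent to the step $$\mathbf{x}_{k+1}=\underset{\mathbf{x}\in C}{\operatorname{argmin}}\big\{F(\mathbf{x})+D_{\ell_k}(\mathbf{x},\mathbf{x}_k)\big\},\qquad \ell_k:=\tfrac{1}{\gamma_k}h-f,$$ i.e. the two minimization problems over $C$ have the same minimizers.
   Context: Setting: $C\subset\mathbb{R}^n$ is a closed convex set with interior $\mathrm{int}\,C$, and the problem is $\min_{\mathbf{x}\in C}F(\mathbf{x})$ with $F:=f+g$. Standing assumptions: (1) $f,g:\mathbb{R}^n\to(-\infty,+\infty]$ are proper, lower semicontinuous and convex; $f$ is differentiable on $\mathrm{int}\,C$; $\operatorname{dom} f\supset C$ and $\operatorname{dom} g\cap\mathrm{int}\,C\neq\emptyset$. (2) $F^*:=\inf_{\mathbf{x}\in C}F(\mathbf{x})>-\infty$ and the solution set $\mathcal{X}^*:=\{\mathbf{x}\in C: F(\mathbf{x})=F^*\}$ is non-empty. (3) $h:\mathbb{R}^n\to(-\infty,+\infty]$ has $\operatorname{dom} h=C$, is continuously differentiable on $\mathrm{int}\,C$, and is strictly convex on $C$. Notation: for a function $\phi$ that is finite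 on $C$ and differentiable on $\mathrm{int}\,C$, and for $\mathbf{x}\in C$, $\mathbf{y}\in\mathrm{int}\,C$, set $D_\phi(\mathbf{x},\mathbf{y}):=\phi(\mathbf{x})-\phi(\mathbf{y})-\langle\mathbf{x}-\mathbf{y},\nabla\phi(\mathbf{y})\rangle$. For $\phi=h$ this is the Bregman distance of $h$; for $\phi=\ell_k$ the same formula is used. ''Well defined'' means: $\mathbf{x}_0\in\mathrm{int}\,C$ and, for every $k$, the minimizer in the PGA-$\mathcal{B}$ step exists, is unique, and lies in $\mathrm{int}\,C$. *)

(* Defs.v *)
(* MathComp-Analysis; R^n is 'rV[R]_n over an arbitrary R : realType. Its library
   norm is the sup norm, so neighbourhoods, interiors, differentials and
   continuity are the usual ones. *)
From HB Require Import structures.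
From mathcomp Require Import all_boot all_order all_algebra.
From mathcomp Require Import all_classical all_reals all_analysis.

Import Order.TTheory GRing.Theory Num.Theory.
Import numFieldNormedType.Exports.

Local Open Scope classical_set_scope.
Local Open Scope ring_scope.

Section bregman.
Context {R : realType} {n : nat}.
Local Notation E := 'rV[R]_n.
Implicit Types (C : set E) (phi f g h : E -> \bar R) (x y z : E) (c : R).

Definition dom phi : set E := [set x | (phi x < +oo)%E].

Definition no_ninfty phi := forall x, (-oo < phi x)%E.

Definition proper_efun phi := no_ninfty phi /\ dom phi !=set0.

(* Only used for functions that never take the value -oo; 0 * +oo = 0 in \bar R,
   so the endpoints t = 0 and t = 1 are harmless. *)
Definition convex_efun phi := forall x y (t : R), 0 <= t <= 1 ->
  (phi (t *: x + (1 - t) *: y)%R <= t%:E * phi x + (1 - t)%R%:E * phi y)%E.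

Definition strictly_convex_on C phi := forall x y (t : R),
  C x -> C y -> x != y -> 0 < t < 1 ->
  (phi (t *: x + (1 - t) *: y)%R < t%:E * phi x + (1 - t)%R%:E * phi y)%E.

Definition dot x y : R := \sum_(i < n) x 0 i * y 0 i.

(* [fine] maps +oo and -oo to 0: the two notions below are the usual ones at a
   point near which [phi] is finite, e.g. in the interior of C when [phi] is
   finite on C. *)
Definition grad phi y : E :=
  \row_(i < n) 'D_(delta_mx 0 i) (fine \o phi : E -> R) y.

Definition differentiable_on C phi :=
  forall y, C y -> differentiable (fine \o phi : E -> R) y.

Definition continuously_differentiable_on C phi :=
  differentiable_on C phi /\ forall y, C y -> {for y, continuous (grad phi)}.

Definition bregman phi x y : \bar R :=
  (phi x - phi y - (dot (x - y)%R (grad phi y))%:E)%E.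

Definition argmin C phi : set E :=
  [set x | C x /\ forall y, C y -> (phi x <= phi y)%E].

(* c is the step size and y the current iterate. *)
Definition pga_objective f g h c y z : \bar R :=
  (g z + (dot z (grad f y))%:E + (c^-1)%R%:E * bregman h z y)%E.

(* The value is only meaningful where h and f are both finite, in particular
   on C. *)
Definition ell f h c : E -> \bar R := fun z => ((c^-1)%R%:E * h z - f z)%E.

Definition pga_well_defined C f g h (gamma : nat -> R) (x : nat -> E) :=
  C° (x 0) /\
  forall k, let M := argmin C (pga_objective f g h (gamma k) (x k)) in
    (exists! z, M z) /\ M `<=` C°.

Definition pga_iterates C f g h (gamma : nat -> R) (x : nat -> E) :=
  forall k, argmin C (pga_objective f g h (gamma k) (x k)) (x k.+1).

End bregman.

(* Main.v *)
(* The Bregman distance is linear in its generating function, so D_ell = D_h / c - D_f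
   where both f and h are finite and differentiable. Hence the objective F + D_ell is
   g + (f - D_f) + D_h / c, and f - D_f is the linearization of f at the current iterate y:
   the two objectives differ on C by the constant f(y) - <y, grad f(y)>. *)
Require Import Defs.
From HB Require Import structures.
From mathcomp Require Import all_boot all_order all_algebra ring.
From mathcomp Require Import all_classical all_reals all_analysis.

Import Order.TTheory GRing.Theory Num.Theory.
Import numFieldNormedType.Exports.

Local Open Scope classical_set_scope.
Local Open Scope ring_scope.

Section bregman_theory.
Context {R : realType} {n : nat}.
Local Notation E := 'rV[R]_n.
Implicit Types (C : set E) (phi psi f g h : E -> \bar R) (x y z u v w : E) (c : R).

Lemma dotBl u v w : dot (u - v) w = dot u w - dot v w.
Proof. by rewrite /dot -sumrB; apply: eq_bigr => i _; rewrite !mxE mulrBl. Qed.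

Lemma dotBr u v w : dot u (v - w) = dot u v - dot u w.
Proof. by rewrite /dot -sumrB; apply: eq_bigr => i _; rewrite !mxE mulrBr. Qed.

Lemma dotZr c u v : dot u (c *: v) = c * dot u v.
Proof. by rewrite /dot mulr_sumr; apply: eq_bigr => i _; rewrite !mxE mulrCA. Qed.

Lemma fine_ell f h c z : f z \is a fin_num -> h z \is a fin_num ->
  fine (ell f h c z) = c^-1 * fine (h z) - fine (f z).
Proof. by move=> ff fh; rewrite /ell fineB ?fineM ?fin_numM. Qed.

(** A gradient depends only on values near [y]. Since [fine] respects the subtraction in [ell] only
    at finite values, [f] and [h] must be finite on a whole neighbourhood of [y], not just at
    [y]. *)
Lemma grad_ell f h c y :
  (\forall z \near y, f z \is a fin_num) ->
  (\forall z \near y, h z \is a fin_num) ->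
  differentiable (fine \o f : E -> R) y ->
  differentiable (fine \o h : E -> R) y ->
  grad (ell f h c) y = c^-1 *: grad h y - grad f y.
Proof.
move=> ff fh df dh; apply/rowP => i; rewrite !mxE.
(* Directional derivatives are local, so [ell] may be replaced by a real-valued combination that
   agrees with it near [y]; linearity of the derivative then applies. *)
have /near_eq_derive -> : \near y,
    (fine \o ell f h c : E -> R) y = (c^-1 \*: (fine \o h) - (fine \o f)) y.
  by near=> z; apply: fine_ell; near: z.
have derf := @diff_derivable _ _ _ _ _ (delta_mx 0 i) df.
have derh := @diff_derivable _ _ _ _ _ (delta_mx 0 i) dh.
by rewrite deriveB ?deriveZ//; exact: derivableZ.
Unshelve. all: by end_near. Qed.

Lemma bregman_ell_objective f g h c y z :
  (-oo < g z)%E -> f z \is a fin_num -> h z \is a fin_num ->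
  (\forall w \near y, f w \is a fin_num) ->
  (\forall w \near y, h w \is a fin_num) ->
  differentiable (fine \o f : E -> R) y ->
  differentiable (fine \o h : E -> R) y ->
  (f z + g z + bregman (ell f h c) z y =
   pga_objective f g h c y z + (fine (f y) - dot y (grad f y))%:E)%E.
Proof.
move=> gz fz hz ffy fhy df dh.
have fy := nbhs_singleton ffy; have hy := nbhs_singleton fhy.
rewrite /pga_objective /bregman grad_ell// /ell.
rewrite -(fineK fz) -(fineK hz) -(fineK fy) -(fineK hy) /=.
rewrite dotBr dotZr (dotBl z y (grad f y)).
(* Only [g z] may still be infinite. If it is [+oo], both sides are [+oo]; otherwise the claim is a
   ring identity over the reals. *)
case: (g z) gz => [r ||]// _.
by rewrite -!(EFinM, EFinB, EFinD); congr EFin; ring.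
Qed.

(** Adding a real constant preserves and reflects the order of [\bar R], also at infinite values. *)
Lemma eq_argmin_addr C phi psi (K : R) :
  (forall z, C z -> psi z = phi z + K%:E)%E -> argmin C phi = argmin C psi.
Proof.
move=> phipsi; apply/seteqP; split=> z [Cz min_z]; split=> // w Cw;
  move: (min_z w Cw); by rewrite !phipsi// leeD2rE.
Qed.

End bregman_theory.

Theorem theorem1 (R : realType) (n : nat) (C : set 'rV[R]_n)
  (f g h : 'rV[R]_n -> \bar R) (gamma : nat -> R) (x : nat -> 'rV[R]_n)
  (F : 'rV[R]_n -> \bar R := (f \+ g)%E) :
  closed C -> convex_set C ->
  (proper_efun f /\ lower_semicontinuous f /\ convex_efun f) ->
  (proper_efun g /\ lower_semicontinuous g /\ convex_efun g) ->
  differentiable_on C° f ->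
  C `<=` dom f ->
  dom g `&` C° !=set0 ->
  (-oo < ereal_inf (F @` C))%E ->
  [set z | C z /\ F z = ereal_inf (F @` C)] !=set0 ->
  no_ninfty h ->
  dom h = C ->
  continuously_differentiable_on C° h ->
  strictly_convex_on C h ->
  (forall k, 0 < gamma k) ->
  pga_well_defined C f g h gamma x ->
  pga_iterates C f g h gamma x ->
  forall k,
    argmin C (pga_objective f g h (gamma k) (x k)) =
    argmin C (fun z => (F z + bregman (ell f h (gamma k)) z (x k))%E).
Proof.
move=> _ _ [[fNy _] _] [[gNy _] _] df Cf _ _ _ hNy domh [dh _] _ _ [x0C wd] xmin k.
(* Every later iterate minimizes the preceding objective, and well-definedness puts such minimizers
   in the interior. *)
have xC : C° (x k) by case: k => [//|k]; have [_] := wd k; apply; exact: xmin.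
have ffin z : C z -> f z \is a fin_num.
  by move=> Cz; rewrite fin_numElt fNy; exact: Cf.
have hfin z : C z -> h z \is a fin_num.
  by rewrite -domh => hz; rewrite fin_numElt hNy.
apply: (@eq_argmin_addr _ _ _ _ _ (fine (f (x k)) - dot (x k) (grad f (x k)))).
move=> z Cz; apply: bregman_ell_objective.
- exact: gNy.
- exact: ffin.
- exact: hfin.
(* As [x k] is interior, [C] is a neighbourhood of it, so finiteness on [C] gives finiteness near
   [x k]. *)
- exact: filterS ffin xC.
- exact: filterS hfin xC.
- exact: df.
- exact: dh.
Qed.
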